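(* Let $\mathbb{F}_q$ be a finite field with $q$ odd, let $n\ge1$ be an integer and let $i\ge 1$ be a divisor of $q^n-1$. Let $A,B,C,a,b,c$ be elements of $\mathbb{F}_q$, with $a\neq 0$, and let $\alpha_1,\alpha_2\in\mathbb{F}_{q^2}$ be the roots of the polynomial $f(x)=ax^2+bx+c$. Let $\mathcal{C}_1: y^i=(Ax^2+Bx+C)(ax^2+bx+c)^{i-1}$ and $\mathcal{C}_2: y^i(ax^2+bx+c)=Ax^2+Bx+C$ be two curves over $\overline{\mathbb{F}_q}$. The numbers of rational points of $\mathcal{C}_1$ and $\mathcal{C}_2$ over $\mathbb{F}_{q^n}$ satisfy $$N_n(\mathcal{C}_1)=N_n(\mathcal{C})-\sum_{j=1}^{i-1}\chi_i^j\left(\tfrac{A}{a}\right)-\delta+\gamma$$ and $$N_n(\mathcal{C}_2)=N_n(\mathcal{C})+1-\sum_{j=1}^{i-1}\chi_i^j\left(\tfrac{A}{a}\right)-\delta,$$ where $\mathcal{C}$ is the curve over $\overline{\mathbb{F}_q}$ (in the variables $y,z$) given by $z^2=(B-by^i)^2-4(A-ay^i)(C-cy^i)$, $\gamma:=\mathbf{1}_{\{\alpha_1\in\mathbb{F}_{q^n}\}}+\mathbf{1}_{\{\alpha_1\in\mathbb{F}_{q^n},\ \alpha_1\neq\alpha_2\}}$ and $$\delta:=\begin{cases} 1+\chi_2(b^2-4ac),&\text{if } i=1;\\ 1+\chi_2(4Ac+4Ca-2Bb),&\text{if } i=2\text{ and } b^2-4ac=0;\\ 1,&\text{otherwise}.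 \end{cases}$$
   Context: For a plane curve $\mathcal{C}$ given by an affine equation over $\mathbb{F}_q$, $N_n(\mathcal{C})$ denotes the number of $\mathbb{F}_{q^n}$-rational points of its projective closure in $\mathbb{P}^2$ (the zero set of the homogenized equation); points at infinity are counted. For $i$ dividing $q^n-1$, $\chi_i$ denotes a multiplicative character of order $i$ on $\mathbb{F}_{q^n}^*$ (dependence on $n$ left implicit), extended to $0$ by $\chi_1(0)=1$ and $\chi_i(0)=0$ for $i\ge2$; in particular $\chi_2$ is the quadratic character of $\mathbb{F}_{q^n}$. $\mathbf{1}_E$ is $1$ if the condition $E$ holds and $0$ otherwise.
   Formalization: Added, as the formulas fail otherwise: (A,B,C) is not t^i(a,b,c) for any t in F_{q^n}; and, for the C_1 formula only, Ax^2+Bx+C and ax^2+bx+c have no common root in F_{q^n}, and not (i=2 and A=B=0). *)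

(* Defs.v *)
From mathcomp Require Import all_boot all_order all_fingroup all_algebra.
From mathcomp Require Import all_field all_character.
From mathcomp.multinomials Require Export mpoly.

Set Implicit Arguments.
Unset Strict Implicit.
Unset Printing Implicit Defensive.

Import GRing.Theory.
Local Open Scope ring_scope.

(* The affine variables keep their indices and the homogenizing variable is
   the last one; msize p is 1 + the total degree of p (and 0 if p = 0).       *)
Definition homogenize n (R : nzRingType) (p : {mpoly R[n]}) : {mpoly R[n.+1]} :=
  \sum_(m <- msupp p)
     p@_m *: (mwiden 'X_[m] * 'X_ord_max ^+ ((msize p).-1 - mdeg m)%N).

(* A point of P^2(L) is a line of L^3, represented by the canonical square
   matrix <<v>> with row space spanned by v. The curve p = 0 is defined over
   K, and its L-rational points are taken along iota : K -> L.                *)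
Definition num_points (K L : finFieldType) (iota : {rmorphism K -> L})
    (p : {mpoly K[2]}) : nat :=
  #|[set <<v>>%MS | v : 'rV[L]_3
        & (v != 0) && ((map_mpoly iota (homogenize p)).@[v 0] == 0)]|.

(* The affine coordinates, in the order in which the curve is given. *)
Definition crd1 (R : nzRingType) : {mpoly R[2]} := 'X_(0 : 'I_2).
Definition crd2 (R : nzRingType) : {mpoly R[2]} := 'X_(1 : 'I_2).
Arguments crd1 {R}.
Arguments crd2 {R}.

Definition quadratic (R : nzRingType) (S : lalgType R) (a b c : R) (x : S) : S :=
  a *: x ^+ 2 + b *: x + c%:A.

Definition curve1 (K : fieldType) (i : nat) (A B C a b c : K) : {mpoly K[2]} :=
  let x : {mpoly K[2]} := crd1 in let y : {mpoly K[2]} := crd2 in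
  y ^+ i - quadratic A B C x * quadratic a b c x ^+ i.-1.

Definition curve2 (K : fieldType) (i : nat) (A B C a b c : K) : {mpoly K[2]} :=
  let x : {mpoly K[2]} := crd1 in let y : {mpoly K[2]} := crd2 in
  y ^+ i * quadratic a b c x - quadratic A B C x.

Definition curve0 (K : fieldType) (i : nat) (A B C a b c : K) : {mpoly K[2]} :=
  let y : {mpoly K[2]} := crd1 in let z : {mpoly K[2]} := crd2 in
  z ^+ 2 - ((B%:A - b *: y ^+ i) ^+ 2
            - 4 * (A%:A - a *: y ^+ i) * (C%:A - c *: y ^+ i)).

(* A multiplicative character of L is a linear character of its unit group;
   its value at 0 is 1 if it is trivial and 0 otherwise. *)
Definition mchar (L : finFieldType) (chi : 'CF([set: {unit L}])) (x : L) : algC :=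
  if insub x is Some u then chi u else (chi == 1)%:R.

Definition delta (K L : finFieldType) (iota : {rmorphism K -> L})
    (chi2 : 'CF([set: {unit L}])) (i : nat) (A B C a b c : K) : algC :=
  if i == 1%N then 1 + mchar chi2 (iota (b ^+ 2 - 4 * a * c))
  else if (i == 2%N) && (b ^+ 2 - 4 * a * c == 0) then
    1 + mchar chi2 (iota (4 * A * c + 4 * C * a - 2 * B * b))
  else 1.

(* L stands for F_{q^n} and E for F_{q^2}; membership of an element of E in L
   is meant inside the common overfield M. *)
Definition gamma (L E : finFieldType) (M : fieldType)
    (jL : {rmorphism L -> M}) (jE : {rmorphism E -> M}) (alpha1 alpha2 : E) : nat :=
  let inL := [exists x : L, jL x == jE alpha1] in
  (inL + (inL && (alpha1 != alpha2)))%N.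

(* Main.v *)
Require Import Defs.
From mathcomp Require Import all_boot all_order all_fingroup all_algebra.
From mathcomp Require Import all_solvable all_field all_character.
From mathcomp Require Import ring zify.

(** The idea is to fibre the affine curves over the y-line. For a fixed y the
    equation y^i f(x) = g(x), with f = a x^2 + b x + c and
    g = A x^2 + B x + C, is a quadratic (possibly degenerate) equation in x
    whose discriminant is the right-hand side of the equation z^2 = D(y) of the
    curve C, and completing the square matches its solutions with the square
    roots of D(y). The match fails by exactly one solution when the leading
    coefficient a y^i - A vanishes, so the affine part of C has
    #{y | y^i = A / a} more points than that of C_2 ([affine_count2]). As the
    unit group of a finite field is cyclic, this number is the character sum
    1 + sum_(1 <= j < i) chi^j(A / a) ([card_power_fibre]).

    The substitution y := y f(x) carries the affine part of C_2 to the part of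
    C_1 where f(x) != 0, and C_1 has one more point above every root of f
    ([affine_count1]); the roots of f are counted by gamma
    ([card_roots_gamma]).

    It remains to count points at infinity. They are the projective zeros of
    the homogeneous component of highest degree of the equation
    ([num_points_split]). This leading form is multiplicative, hence easy to
    compute from a factored equation, and it turns out to be
    - the monomial a x^2 y^i for C_2, with two zeros;
    - a nonzero multiple of a power of x (or y - B x if C_1 is a line) for C_1,
      with one zero;
    - a nonzero multiple of a power of y (one zero) or z^2 - k y^2 (with
      1 + chi_2(k) zeros) for C, and the case distinction gives delta
      ([num_points_curve0]). *)

Import GRing.Theory.
Local Open Scope ring_scope.

(** * Leading forms and homogenization *)

Section LeadingForm.
Context {n : nat} {R : idomainType}.
Implicit Types p t s : {mpoly R[n]}.

(** The component of degree d of a polynomial of degree at most d. As t = 0 is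
    allowed, the relation is additive and multiplicative without side
    conditions, so that the leading form of an expression can be computed
    factor by factor and term by term. *)
Definition leading_form (d : nat) (p t : {mpoly R[n]}) : Prop :=
  t \is d.-homog /\ (msize (p - t) <= d)%N.

Lemma dhomog_msize_le {d t} : t \is d.-homog -> (msize t <= d.+1)%N.
Proof.
move=> /dhomogP ht; rewrite msizeE; apply/bigmax_leqP_seq => m mt _.
by rewrite ht.
Qed.

Lemma leading_form_msize {d p t} : leading_form d p t -> (msize p <= d.+1)%N.
Proof.
case=> ht hr; rewrite -[p](subrK t).
apply: leq_trans (msizeD_le _ _) _.
by rewrite geq_max (dhomog_msize_le ht) andbT leqW.
Qed.

Lemma leading_form_homog d p : p \is d.-homog -> leading_form d p p.
Proof. by move=> hp; split=> //; rewrite subrr msize0. Qed.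

Lemma leading_form_lower {d e p t} :
  (e < d)%N -> leading_form e p t -> leading_form d p 0.
Proof.
move=> lt_ed hp; split; first exact: dhomog0.
by rewrite subr0 (leq_trans (leading_form_msize hp)).
Qed.

Lemma leading_formD {d p t q s} : leading_form d p t -> leading_form d q s ->
  leading_form d (p + q) (t + s).
Proof.
move=> [ht hp] [hs hq]; split; first exact: rpredD.
rewrite opprD addrACA; apply: leq_trans (msizeD_le _ _) _.
by rewrite geq_max hp.
Qed.

Lemma leading_formN {d p t} : leading_form d p t -> leading_form d (- p) (- t).
Proof.
by move=> [ht hp]; split; rewrite ?rpredN // -opprD msizeN.
Qed.

Lemma leading_formZ {d p t} c :
  leading_form d p t -> leading_form d (c *: p) (c *: t).
Proof.
move=> [ht hp]; split; first exact: rpredZ.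
by rewrite -scalerBr (leq_trans (msizeZ_le _ _)).
Qed.

Lemma leading_formM {d e p t q s} : leading_form d p t -> leading_form e q s ->
  leading_form (d + e) (p * q) (t * s).
Proof.
move=> hpt hqs; have sq := leading_form_msize hqs.
case: hpt hqs => [ht hp] [hs hq]; split; first exact: dhomogM.
have -> : p * q - t * s = (p - t) * q + t * (q - s) by ring.
have mM (f g : {mpoly R[n]}) k l : (msize f <= k -> msize g <= l ->
    k + l = (d + e).+1 -> msize (f * g) <= d + e)%N.
  move=> hf hg hkl; have [->|f0] := eqVneq f 0; first by rewrite mul0r msize0.
  have [->|g0] := eqVneq g 0; first by rewrite mulr0 msize0.
  by rewrite msizeM // -[leqRHS]/(_.+1.-1) -hkl -!subn1 leq_sub2r // leq_add.
apply: leq_trans (msizeD_le _ _) _; rewrite geq_max; apply/andP; split.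
  by apply: mM hp sq _; rewrite addnS.
by apply: mM (dhomog_msize_le ht) hq _; rewrite addSn.
Qed.

Lemma leading_formX {d p t} k :
  leading_form d p t -> leading_form (d * k) (p ^+ k) (t ^+ k).
Proof.
move=> hp; elim: k => [|k IHk].
  by rewrite muln0 !expr0; apply: leading_form_homog; apply: dhomog1.
by rewrite mulnS !exprS; apply: leading_formM.
Qed.

Lemma leading_form_pihomog {d p t} : leading_form d p t -> pihomog mdeg d p = t.
Proof.
move=> [ht hr]; rewrite -[p](subrK t) raddfD /= (pihomog_dE ht).
rewrite [pihomog _ _ _]big1_seq ?add0r // => m /andP[/eqP md mr].
by have := msize_mdeg_lt mr; rewrite md ltnNge hr.
Qed.

Lemma leading_form_msizeE {d p t} :
  leading_form d p t -> t != 0 -> msize p = d.+1.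
Proof.
move=> hpt t0; apply/eqP; rewrite eqn_leq (leading_form_msize hpt) /=.
rewrite ltnNge; apply: contra t0 => hp; rewrite -(leading_form_pihomog hpt).
rewrite pihomogE big1_seq // => m /andP[/eqP md mp].
by have := msize_mdeg_lt mp; rewrite md ltnNge hp.
Qed.
End LeadingForm.

Lemma homogenize_eval (n : nat) (R S : comNzRingType) (f : {rmorphism R -> S})
    (p : {mpoly R[n]}) (v : 'I_n.+1 -> S) :
  (map_mpoly f (homogenize p)).@[v] =
  \sum_(m <- msupp p) (f p@_m * \prod_(i < n) v (widen_ord (leqnSn n) i) ^+ m i)
     * v ord_max ^+ ((msize p).-1 - mdeg m).
Proof.
rewrite /homogenize (raddf_sum (map_mpoly f)) (raddf_sum (meval _)) /=.
apply: eq_bigr => m _.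
rewrite map_mpolyZ mevalZ mwidenX -mulrA; congr (_ * _).
rewrite rmorphM rmorphXn /= !map_mpolyX rmorphM rmorphXn /= mevalXU.
congr (_ * _).
rewrite mevalX big_ord_recr /= mnmwiden_ordmax expr0 mulr1.
by apply: eq_bigr => i _; rewrite mnmwiden_widen.
Qed.

Lemma homogenize_affine (n : nat) (R S : comNzRingType) (f : {rmorphism R -> S})
    (p : {mpoly R[n]}) (v : 'I_n.+1 -> S) : v ord_max = 1 ->
  (map_mpoly f (homogenize p)).@[v] =
  (map_mpoly f p).@[fun i => v (widen_ord (leqnSn n) i)].
Proof.
move=> v1; rewrite homogenize_eval v1 [in RHS](mpolyE p).
rewrite (raddf_sum (map_mpoly f)) (raddf_sum (meval _)) /=.
apply: eq_bigr => m _.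
by rewrite expr1n mulr1 map_mpolyZ mevalZ map_mpolyX mevalX.
Qed.

(** At w = 0 only the monomials of top degree survive in the homogenization,
    since every other one carries a positive power of w. *)
Lemma homogenize_infinity (n : nat) (R : idomainType) (S : comNzRingType)
    (f : {rmorphism R -> S})
    {d : nat} {p t : {mpoly R[n]}} (v : 'I_n.+1 -> S) :
  leading_form d p t -> t != 0 -> v ord_max = 0 ->
  (map_mpoly f (homogenize p)).@[v] =
  (map_mpoly f t).@[fun i => v (widen_ord (leqnSn n) i)].
Proof.
move=> pt t0 v0; rewrite homogenize_eval v0.
rewrite -(leading_form_pihomog pt) pihomogE.
rewrite (raddf_sum (map_mpoly f)) (raddf_sum (meval _)) /= [RHS]big_mkcond /=.
rewrite (leading_form_msizeE pt t0) /=.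
apply: eq_big_seq => m mp.
have := msize_mdeg_lt mp; rewrite (leading_form_msizeE pt t0) ltnS.
rewrite leq_eqVlt; case: eqP => [-> _|/= _ md].
  by rewrite subnn expr0 mulr1 map_mpolyZ mevalZ map_mpolyX mevalX.
by rewrite expr0n subn_eq0 leqNgt md mulr0.
Qed.

Lemma homogenize_scale (n : nat) (R S : comNzRingType) (f : {rmorphism R -> S})
    (p : {mpoly R[n]}) (c : S) (v : 'I_n.+1 -> S) :
  (map_mpoly f (homogenize p)).@[fun i => c * v i] =
  c ^+ (msize p).-1 * (map_mpoly f (homogenize p)).@[v].
Proof.
rewrite !homogenize_eval mulr_sumr; apply: eq_big_seq => m mp.
have hd : (mdeg m <= (msize p).-1)%N.
  by have := msize_mdeg_lt mp; case: (msize p).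
rewrite (eq_bigr (fun i => c ^+ m i * v (widen_ord (leqnSn n) i) ^+ m i));
  last first.
  by move=> i _; rewrite exprMn.
rewrite big_split /= prodrXr -mdegE exprMn.
rewrite -(subnKC hd) [in RHS]exprD addKn.
move: (_ - _)%N (f _) (\prod_(i < n) _) (c ^+ mdeg m) => k F P T.
by ring.
Qed.

(** * Affine points and points at infinity *)

(** The default value of the list lookup is never reached for an index in 'I_2;
    the same holds for [normalized] below. *)
Definition affine_point {L : nzRingType} (x y : L) (j : 'I_2) : L :=
  [:: x; y]`_j.

(** The three summands are the cells of the projective plane: the affine plane,
    the affine line at infinity and its point at infinity. *)
Definition normalized {L : nzRingType} (s : L * L + (L + unit)) : 'rV[L]_3 :=
  \row_j (match s with
          | inl (x, y) => [:: x; y; 1]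
          | inr (inl y) => [:: 1; y; 0]
          | inr (inr _) => [:: 0; 1; 0]
          end)`_j.

Lemma rV3P {L : nzRingType} (u v : 'rV[L]_3) :
  u 0 0 = v 0 0 -> u 0 1 = v 0 1 -> u 0 ord_max = v 0 ord_max -> u = v.
Proof.
move=> e0 e1 e2; apply/rowP => -[[|[|[|//]]] hj].
- by rewrite (_ : Ordinal hj = 0) //; apply: val_inj.
- by rewrite (_ : Ordinal hj = 1) //; apply: val_inj.
by rewrite (_ : Ordinal hj = ord_max) //; apply: val_inj.
Qed.

Lemma normalizedP {L : fieldType} (v : 'rV[L]_3) : v != 0 ->
  exists s c, c != 0 /\ v = c *: normalized s.
Proof.
move=> v0; have [w0|w0] := eqVneq (v 0 ord_max) 0; last first.
  exists (inl (v 0 0 / v 0 ord_max, v 0 1 / v 0 ord_max)), (v 0 ord_max).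
  by split=> //; apply: rV3P; rewrite !mxE /= ?mulr1 // mulrC divfK.
have [x0|x0] := eqVneq (v 0 0) 0; last first.
  exists (inr (inl (v 0 1 / v 0 0))), (v 0 0).
  by split=> //; apply: rV3P; rewrite !mxE /= ?mulr1 ?mulr0 // mulrC divfK.
exists (inr (inr tt)), (v 0 1); split; last first.
  by apply: rV3P; rewrite !mxE /= ?mulr1 ?mulr0.
apply: contraNneq v0 => y0; apply/eqP; apply: rV3P; by rewrite ?x0 ?y0 ?w0 mxE.
Qed.

Lemma normalized_inj {L : fieldType} :
  injective (fun s : L * L + (L + unit) => <<normalized s>>%MS).
Proof.
move=> s s' /genmxP/andP[/sub_rVP[k e] _].
have /= := congr1 (fun u : 'rV_3 => u 0 0) e.
have /= := congr1 (fun u : 'rV_3 => u 0 1) e.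
have /= := congr1 (fun u : 'rV_3 => u 0 ord_max) e.
rewrite !mxE /= => {e}.
case: s s' => [[x y]|[y|[]]] [[x' y']|[y'|[]]] /=; rewrite ?mulr0 ?mulr1.
- by move=> <-; rewrite !mul1r => -> ->.
- by move=> /eqP; rewrite oner_eq0.
- by move=> /eqP; rewrite oner_eq0.
- by move=> <- _ /eqP; rewrite mul0r oner_eq0.
- by move=> _ -> <-; rewrite mul1r.
- by move=> _ _ /eqP; rewrite oner_eq0.
- by move=> <- /eqP; rewrite mul0r oner_eq0.
- by move=> _ + ek; rewrite -ek mul0r => /eqP; rewrite oner_eq0.
- by [].
Qed.

(** The normalized vectors represent every projective point once. On the affine
    plane the homogenization is the polynomial itself, and on the line at
    infinity it is the leading form; that t is nonzero ensures that d is the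
    degree used by the homogenization. *)
Lemma num_points_split (K L : finFieldType) (iota : {rmorphism K -> L})
    (d : nat) (p t : {mpoly K[2]}) : leading_form d p t -> t != 0 ->
  num_points iota p =
  (#|[set xy : L * L | (map_mpoly iota p).@[affine_point xy.1 xy.2] == 0%R]|
   + (#|[set y : L | (map_mpoly iota t).@[affine_point 1%R y] == 0%R]|
      + ((map_mpoly iota t).@[affine_point 0%R 1%R] == 0%R)))%N.
Proof.
move=> pt t0; rewrite /num_points.
set h := fun v : 'rV[L]_3 => (map_mpoly iota (homogenize p)).@[v 0] == 0%R.
have -> : [set <<v>>%MS | v : 'rV[L]_3 & (v != 0) && h v]
  = [set <<normalized s>>%MS | s in [set s | h (normalized s)]].
  apply/setP => U; apply/imsetP/imsetP => [[v]|[s]].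
    rewrite inE => /andP[v0 hv] ->.
    have [s [k [k0 e]]] := normalizedP v v0; exists s; last first.
      by apply/genmxP; rewrite e; apply/eqmxP; apply: eqmx_scale.
    rewrite inE; move: hv; rewrite /h e.
    rewrite (meval_eq (v2 := fun i => k * normalized s 0 i)); last first.
      by move=> i; rewrite mxE.
    by rewrite homogenize_scale mulf_eq0 expf_eq0 (negPf k0) andbF.
  rewrite inE => hs ->; exists (normalized s) => //.
  rewrite inE hs andbT; apply/eqP => e.
  move: (congr1 (fun u : 'rV_3 => u 0 0) e).
  move: (congr1 (fun u : 'rV_3 => u 0 1) e).
  move: (congr1 (fun u : 'rV_3 => u 0 ord_max) e).
  by rewrite !mxE; case: s {hs e} => [[x y]|[y|[]]] /= => [/eqP|_ _ /eqP|_ /eqP];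
    rewrite oner_eq0.
rewrite card_imset; last exact: normalized_inj.
rewrite -!sum1_card big_mkcond big_sumType big_sumType /=.
congr (_ + (_ + _))%N.
- rewrite [RHS]big_mkcond; apply: eq_bigr => -[x y] _.
  rewrite !inE /h homogenize_affine ?mxE //.
  congr (if _ == 0 then _ else _); apply: meval_eq => -[[|[|//]] hj];
    by rewrite mxE.
- rewrite [RHS]big_mkcond; apply: eq_bigr => y _.
  rewrite !inE /h (homogenize_infinity _ _ _ _ _ pt t0) ?mxE //.
  congr (if _ == 0 then _ else _); apply: meval_eq => -[[|[|//]] hj];
    by rewrite mxE.
rewrite (big_pred1 tt); last by case.
rewrite !inE /h (homogenize_infinity _ _ _ _ _ pt t0) ?mxE //.
rewrite (meval_eq (v2 := affine_point 0 1)); first by case: eqP.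
by move=> -[[|[|//]] hj]; rewrite mxE.
Qed.

(** * Power equations and characters *)

(** A nonempty fibre of y |-> y^i is a coset of the kernel, and the kernel is
    generated by g^m, where #[g] = m i. *)
Lemma cycle_power_fibre (gT : finGroupType) (g : gT) (i : nat) (u : gT) :
  (i %| #[g]%g)%N ->
  #|[set y in <[g]>%g | (y ^+ i)%g == u]| =
  (if [exists y in <[g]>%g, (y ^+ i)%g == u] then i else 0)%N.
Proof.
move=> /dvdnP[m Nim]; have N0 := order_gt0 g; rewrite Nim muln_gt0 in N0.
have [m0 i0] := andP N0.
case: ifP => [/exists_inP[y0 y0g /eqP y0u]|/exists_inP none]; last first.
  apply/eqP; rewrite cards_eq0; apply/eqP/setP => y; rewrite !inE.
  by apply/negP => /andP[yg yu]; apply: none; exists y.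
have -> : [set y in <[g]>%g | (y ^+ i)%g == u] = (y0 *: <[(g ^+ m)%g]>)%g.
  apply/setP => y; rewrite !inE mem_lcoset.
  apply/andP/cycleP => [[yg /eqP yu]|[k ky]].
    have /cycleP[l e] : (y0^-1 * y)%g \in <[g]>%g by rewrite groupM ?groupV.
    have : (#[g]%g %| l * i)%N.
      have c : commute y0^-1%g y.
        by apply: (centsP (cycle_abelian g)); rewrite ?groupV.
      by rewrite order_dvdn expgM -e expgMn // expgVn y0u yu mulVg.
    rewrite Nim dvdn_pmul2r // => /dvdnP[k lk]; exists k.
    by rewrite e lk mulnC expgM.
  have -> : y = (y0 * g ^+ (m * k))%g by rewrite expgM -ky mulKVg.
  rewrite groupM ?mem_cycle //; split=> //.
  have c : commute y0 (g ^+ (m * k))%g.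
    by apply: (centsP (cycle_abelian g)); rewrite ?mem_cycle.
  rewrite expgMn // y0u -expgM mulnAC -Nim expgM expg_order expg1n mulg1.
  exact: eqxx.
rewrite card_lcoset -[LHS]/(#[g ^+ m])%g orderXdiv ?Nim ?dvdn_mulr //.
by rewrite mulKn.
Qed.

Section PowerCount.
Context {L : finFieldType} {chi : 'CF([set: {unit L}])}.
Context (chi_lin : chi \is a linear_char).
Local Notation i := (#[chi]%CF).

Let i_gt0 : (0 < i)%N := cforder_lin_char_gt0 chi_lin.

(** For a generator g the root of unity chi(g) has order exactly #[chi], as a
    character is determined by chi(g). Hence chi(g^k) = 1 forces #[chi] to
    divide k. *)
Lemma lin_char_eq1_power (u : {unit L}) :
  (chi u == 1) = [exists y, (y ^+ i)%g == u].
Proof.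
have chiX (v : {unit L}) k : chi (v ^+ k)%g = chi v ^+ k.
  by rewrite lin_charX ?inE.
have chi_i v : chi v ^+ i = 1.
  have := congr1 (fun phi : 'CF(_) => phi v) (exp_cforder chi).
  by rewrite exp_cfunE ?inE // cfun1E inE.
apply/eqP/existsP => [chi_u|[y /eqP <-]]; last by rewrite chiX.
have /cyclicP[g Lg] := field_unit_group_cyclic [set: {unit L}]%G.
have in_g v : v \in <[g]>%g by rewrite -Lg inE.
have /cycleP[k uk] := in_g u.
have /dvdnP[l kl] : (i %| k)%N.
  rewrite dvdn_cforder; apply/eqP/cfunP => v; have /cycleP[l ->] := in_g v.
  rewrite exp_cfunE ?inE // cfun1E inE chiX -exprM mulnC exprM.
  by rewrite -chiX -uk chi_u expr1n.
by exists (g ^+ l)%g; rewrite -expgM -kl uk.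
Qed.

(** Both sides are #[chi] if chi(u) = 1; otherwise both vanish, the right-hand
    side being a geometric sum of a nontrivial #[chi]-th root of unity. *)
Lemma card_power_fibre_unit (u : {unit L}) :
  #|[set y | (y ^+ i)%g == u]|%:R = \sum_(0 <= j < i) chi u ^+ j.
Proof.
have /cyclicP[g Lg] := field_unit_group_cyclic [set: {unit L}]%G.
have in_g v : v \in <[g]>%g by rewrite -Lg inE.
have i_dvd : (i %| #[g]%g)%N.
  rewrite orderE -(congr1 (fun G : {set _} => #|G|) Lg).
  exact: cforder_lin_char_dvdG.
have -> : [set y | (y ^+ i)%g == u] = [set y in <[g]>%g | (y ^+ i)%g == u].
  by apply/setP => y; rewrite !inE in_g.
rewrite (cycle_power_fibre _ _ _ _ i_dvd).
have -> : [exists y in <[g]>%g, (y ^+ i)%g == u] = (chi u == 1).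
  by rewrite lin_char_eq1_power; apply: eq_existsb => y; rewrite in_g.
have [->|chi_u] := eqVneq (chi u) 1.
  rewrite (eq_bigr (fun _ => 1)) ?sumr_const_nat ?subn0 // => j _.
  exact: expr1n.
have := congr1 (fun phi : 'CF(_) => phi u) (exp_cforder chi).
rewrite exp_cfunE ?inE // cfun1E inE big_mkord => /eqP.
by rewrite -subr_eq0 subrX1 mulf_eq0 subr_eq0 (negPf chi_u) => /eqP.
Qed.

(** At d = 0 the only root is 0, and the sum vanishes because it is empty when
    chi is trivial, while chi takes the value 0 there otherwise. *)
Lemma card_power_fibre (d : L) :
  #|[set y : L | y ^+ i == d]|%:R = 1 + \sum_(1 <= j < i) mchar chi d ^+ j.
Proof.
have [->|d0] := eqVneq d 0.
  rewrite (_ : [set _ | _] = [set 0]) ?cards1; last first.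
    by apply/setP => y; rewrite !inE expf_eq0 i_gt0.
  rewrite big1_seq ?addr0 // => j /andP[_].
  rewrite mem_index_iota => /andP[j1 ji].
  rewrite /mchar insubF ?unitr0 //.
  have -> : (chi == 1) = false.
    apply: contraTF (leq_ltn_trans j1 ji) => chi1.
    have : (i %| 1)%N by rewrite dvdn_cforder expr1.
    by rewrite dvdn1 => /eqP ->.
  by rewrite expr0n eqn0Ngt j1.
have ud : d \is a GRing.unit by rewrite unitfE.
rewrite /mchar insubT; set u : {unit L} := Sub d ud.
rewrite -[1](expr0 (chi u)) -big_ltn // -card_power_fibre_unit.
rewrite -(card_imset _ val_inj); congr (_%:R); apply: eq_card => y.
rewrite inE; apply/eqP/imsetP => [yd|[v]]; last first.
  by rewrite inE => /eqP vu ->; rewrite -FinRing.val_unitX vu.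
have uy : y \is a GRing.unit by rewrite -(unitrX_pos _ i_gt0) yd.
exists (Sub y uy) => //; rewrite inE; apply/eqP; apply: val_inj.
by rewrite FinRing.val_unitX.
Qed.
End PowerCount.

(** * Affine point counts *)

(** As #|K| kills the additive group, 2 = 0 would give 1 = 0 for #|K| odd. *)
Lemma odd_card_2_neq0 (K : finFieldType) : odd #|K| -> (2 : K) != 0.
Proof.
move=> oddK; apply/eqP => two0.
have /eqP : (#|K|%:R : K) == 0.
  have /= := expg_cardG (in_setT (1 : K)).
  by rewrite cardsT FinRing.zmodXgE => ->.
rewrite -(odd_double_half #|K|) oddK natrD -muln2 natrM two0 mulr0 addr0.
by move/eqP; rewrite oner_eq0.
Qed.

Section AffineCounts.
Context {L : finFieldType}.
Implicit Types (A B C a b c : L) (i : nat).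

Lemma card_pairs_snd (P : L -> L -> bool) :
  #|[set xy : L * L | P xy.1 xy.2]| = (\sum_y #|[set x | P x y]|)%N.
Proof.
rewrite -sum1_card big_mkcond /=.
rewrite (eq_bigr (fun xy => P xy.1 xy.2 : nat)); last first.
  by move=> xy _; rewrite inE; case: P.
rewrite -(pair_bigA _ (fun x y => P x y : nat)) exchange_big /=.
apply: eq_bigr => y _; rewrite -sum1_card [RHS]big_mkcond /=.
by apply: eq_bigr => x _; rewrite inE; case: P.
Qed.

Lemma card_pairs_fst (P : L -> L -> bool) :
  #|[set xy : L * L | P xy.1 xy.2]| = (\sum_x #|[set y | P x y]|)%N.
Proof.
rewrite -(card_pairs_snd (fun y x => P x y)).
have swapK : involutive (fun xy : L * L => (xy.2, xy.1)) by case.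
rewrite -(card_imset _ (inv_inj swapK)); apply: eq_card => -[x y].
rewrite inE /=; apply/imsetP/idP => [[[x' y']]|Pyx].
  by rewrite inE /= => Pxy [-> ->].
by exists (y, x) => //; rewrite inE.
Qed.

Context (two_neq0 : (2 : L) != 0).

(** Completing the square: for a != 0 the map x |-> 2 a x + b sends the roots
    onto the square roots of the discriminant. In the degenerate case a = 0 the
    discriminant b^2 has one square root more than the equation has roots: 2
    against 1 if b != 0, and 1 against 0 if b = 0. *)
Lemma card_quadratic_roots a b c : ~ [/\ a = 0, b = 0 & c = 0] ->
  (#|[set x : L | (a * x ^+ 2 + b * x + c == 0)%R]| + (a == 0%R) =
   #|[set z : L | (z ^+ 2 == b ^+ 2 - 4 * a * c)%R]|)%N.
Proof.
move=> abc; have [a0|a0] := eqVneq a 0; last first.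
  have a2 : 2 * a != 0 by rewrite mulf_neq0.
  rewrite addn0.
  have inj : injective (fun x => 2 * a * x + b).
    by move=> x y /addIr /(mulfI a2).
  rewrite -(card_imset _ inj); apply: eq_card => z.
  have key x : (2 * a * x + b) ^+ 2 - (b ^+ 2 - 4 * a * c)
             = 4 * a * (a * x ^+ 2 + b * x + c) by ring.
  have a4 : 4 * a != 0 by rewrite (_ : 4 * a = 2 * (2 * a)) ?mulf_neq0 //; ring.
  rewrite [RHS]inE; apply/imsetP/eqP => [[x]|zd].
    rewrite inE => /eqP e ->; apply/eqP; by rewrite -subr_eq0 key e mulr0.
  exists ((z - b) / (2 * a)); last by rewrite mulrC divfK // subrK.
  rewrite inE; apply/eqP/(mulfI a4); rewrite -key mulr0.
  by rewrite [2 * a * _]mulrC divfK // subrK zd subrr.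
rewrite a0 mulr0 mul0r subr0 /=.
have [b0|b0] := eqVneq b 0; last first.
  rewrite (_ : [set x | _] = [set - c / b]); last first.
    apply/setP => x; rewrite !inE mul0r add0r addr_eq0 [b * x]mulrC.
    by rewrite -[RHS](inj_eq (mulIf b0)) divfK.
  rewrite (_ : [set z | _] = [set b; - b]); last first.
    by apply/setP => z; rewrite !inE eqf_sqr.
  rewrite cards1 cards2 (_ : b != - b) // -subr_eq0 opprK -mulr2n -mulr_natl.
  exact: mulf_neq0.
have c0 : c != 0 by apply/eqP => c0; apply: abc.
rewrite (_ : [set x | _] = set0) ?cards0; last first.
  by apply/setP => x; rewrite !inE b0 !mul0r !add0r (negPf c0).
rewrite (_ : [set z | _] = [set 0]) ?cards1 //.
by apply/setP => z; rewrite !inE b0 expr0n /= sqrf_eq0.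
Qed.

(** Fibrewise use of [card_quadratic_roots] over the y-line. The hypothesis on
    proportionality says that no fibre is the zero equation, and the correcting
    term counts the fibres whose leading coefficient vanishes. *)
Lemma affine_count2 i A B C a b c : a != 0 ->
  ~ (exists t : L, [/\ A = t ^+ i * a, B = t ^+ i * b & C = t ^+ i * c]) ->
  (#|[set xy : L * L | (xy.2 ^+ i * (a * xy.1 ^+ 2 + b * xy.1 + c)
                        == A * xy.1 ^+ 2 + B * xy.1 + C)%R]|
   + #|[set y : L | (y ^+ i == A / a)%R]| =
   #|[set yz : L * L | (yz.2 ^+ 2 ==
       (B - b * yz.1 ^+ i) ^+ 2
       - 4 * (A - a * yz.1 ^+ i) * (C - c * yz.1 ^+ i))%R]|)%N.
Proof.
move=> a0 nprop.
rewrite (card_pairs_snd (fun x y =>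
  y ^+ i * (a * x ^+ 2 + b * x + c) == A * x ^+ 2 + B * x + C)).
rewrite (card_pairs_fst (fun y z => z ^+ 2 ==
  (B - b * y ^+ i) ^+ 2 - 4 * (A - a * y ^+ i) * (C - c * y ^+ i))).
rewrite -[#|[set y : L | _ == A / a]|]sum1_card.
rewrite [X in (_ + X)%N]big_mkcond -big_split /=.
apply: eq_bigr => y _.
rewrite -card_quadratic_roots; last first.
  case=> /subr0_eq eA /subr0_eq eB /subr0_eq eC.
  by apply: nprop; exists y; rewrite ![y ^+ i * _]mulrC.
congr (_ + _)%N; last first.
  rewrite inE subr_eq0 [a * _]mulrC -[in LHS](inj_eq (mulIf a0)) divfK //.
  rewrite eq_sym.
  by case: eqP.
apply: eq_card => x; rewrite !inE eq_sym -subr_eq0; congr (_ == 0); ring.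
Qed.

(** Over an x with f(x) != 0 multiplication by f(x) is a bijection between the
    fibres. Over a root x of f the curve C_2 has no point, as g(x) != 0, and
    C_1 has exactly one: y = 0 if i >= 2, and y = g(x) if i = 1. *)
Lemma affine_count1 i A B C a b c : (0 < i)%N ->
  ~ (exists x, A * x ^+ 2 + B * x + C = 0 /\ a * x ^+ 2 + b * x + c = 0) ->
  (#|[set xy : L * L | (xy.2 ^+ i ==
        (A * xy.1 ^+ 2 + B * xy.1 + C)
        * (a * xy.1 ^+ 2 + b * xy.1 + c) ^+ i.-1)%R]| =
   #|[set xy : L * L | (xy.2 ^+ i * (a * xy.1 ^+ 2 + b * xy.1 + c)
                        == A * xy.1 ^+ 2 + B * xy.1 + C)%R]|
   + #|[set x : L | (a * x ^+ 2 + b * x + c == 0)%R]|)%N.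
Proof.
move=> i0 ncom.
rewrite (card_pairs_fst (fun x y =>
  y ^+ i * (a * x ^+ 2 + b * x + c) == A * x ^+ 2 + B * x + C)).
rewrite (card_pairs_fst (fun x y => y ^+ i ==
  (A * x ^+ 2 + B * x + C) * (a * x ^+ 2 + b * x + c) ^+ i.-1)).
rewrite -[#|[set x | a * _ + _ + _ == _]|]sum1_card.
rewrite [X in (_ + X)%N]big_mkcond -big_split /=.
apply: eq_bigr => x _; rewrite inE.
set g := A * x ^+ 2 + B * x + C; set f := a * x ^+ 2 + b * x + c.
have [f0|f0] := eqVneq f 0.
  have g0 : g != 0 by apply/eqP => g0; apply: ncom; exists x.
  rewrite f0 (_ : [set y | _ * 0 == _] = set0) ?cards0; last first.
    by apply/setP => y; rewrite !inE mulr0 eq_sym (negPf g0).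
  case: i i0 => [//|[|i]] _ /=.
    rewrite expr0 mulr1 (_ : [set y | _] = [set g]) ?cards1 //.
    by apply/setP => y; rewrite !inE expr1.
  rewrite (_ : [set y | _] = [set 0]) ?cards1 //.
  by apply/setP => y; rewrite !inE expr0n mulr0 expf_eq0.
rewrite addn0 -[in RHS](card_imset _ (mulIf f0)); apply: eq_card => y.
rewrite inE; apply/eqP/imsetP => [e|[z]]; last first.
  rewrite inE => /eqP <- ->; rewrite exprMn -{2}(prednK i0) exprS.
  by rewrite mulrA.
exists (y / f); last by rewrite divfK.
rewrite inE exprMn e -mulrA -{2}(prednK i0) exprVn exprSr invfM.
by rewrite -!mulrA mulVf // mulr1 divff ?mulr1 // expf_neq0.
Qed.
End AffineCounts.

(** * Evaluation of the three equations *)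

Section Evaluation.
Context {K L : fieldType} (iota : {rmorphism K -> L}).
Implicit Types (A B C a b c : K) (x y : L).

(** Evaluation at a rational point, packed as a ring morphism so that the
    equations of the curves can be evaluated by rewriting. *)
Definition ev x y : {rmorphism {mpoly K[2]} -> L} :=
  (meval (affine_point x y) \o map_mpoly iota).

Lemma ev_crd1 x y : ev x y crd1 = x.
Proof. by rewrite /ev /= map_mpolyX mevalXU. Qed.

Lemma ev_crd2 x y : ev x y crd2 = y.
Proof. by rewrite /ev /= map_mpolyX mevalXU. Qed.

Lemma evZ x y k p : ev x y (k *: p) = iota k * ev x y p.
Proof. by rewrite /ev /= map_mpolyZ mevalZ. Qed.

Lemma ev_quadratic x y a b c :
  ev x y (quadratic a b c crd1) = iota a * x ^+ 2 + iota b * x + iota c.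
Proof.
by rewrite /quadratic !rmorphD !evZ rmorphXn rmorph1 mulr1 ev_crd1.
Qed.

Lemma ev_curve1 x y i A B C a b c :
  ev x y (curve1 i A B C a b c) =
  y ^+ i - (iota A * x ^+ 2 + iota B * x + iota C)
           * (iota a * x ^+ 2 + iota b * x + iota c) ^+ i.-1.
Proof.
by rewrite /curve1 rmorphB rmorphM !rmorphXn ev_crd2 !ev_quadratic.
Qed.

Lemma ev_curve2 x y i A B C a b c :
  ev x y (curve2 i A B C a b c) =
  y ^+ i * (iota a * x ^+ 2 + iota b * x + iota c)
  - (iota A * x ^+ 2 + iota B * x + iota C).
Proof.
by rewrite /curve2 rmorphB rmorphM !rmorphXn ev_crd2 !ev_quadratic.
Qed.

Lemma ev_curve0 y z i A B C a b c :
  ev y z (curve0 i A B C a b c) =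
  z ^+ 2 - ((iota B - iota b * y ^+ i) ^+ 2
    - 4 * (iota A - iota a * y ^+ i) * (iota C - iota c * y ^+ i)).
Proof.
rewrite /curve0 !(rmorphB, rmorphM, rmorphXn, rmorph_nat) !evZ.
by rewrite rmorphXn rmorph1 !mulr1 ev_crd1 ev_crd2.
Qed.
End Evaluation.

(** * Points at infinity of the three curves *)

Section Infinity.
Context {K L : finFieldType} (iota : {rmorphism K -> L}).
Implicit Types (p t : {mpoly K[2]}).

Definition affine_points p : nat :=
  #|[set xy : L * L | ev iota xy.1 xy.2 p == 0]|.

(** The line at infinity is split into the points (1 : y : 0) and the point
    (0 : 1 : 0). *)
Definition infinity_points t : nat :=
  (#|[set y | ev iota 1%R y t == 0%R]| + (ev iota 0%R 1%R t == 0%R))%N.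

Lemma ev_neq0 x y t : ev iota x y t != 0 -> t != 0.
Proof. by apply: contraNneq => ->; rewrite rmorph0. Qed.

Lemma num_pointsE d p t : leading_form d p t -> t != 0 ->
  num_points iota p = (affine_points p + infinity_points t)%N.
Proof. exact: num_points_split. Qed.

(** The only zero of x^d at infinity is (0 : 1 : 0). *)
Lemma num_points_pure d p k : k != 0 -> (0 < d)%N ->
  leading_form d p (k *: crd1 ^+ d) ->
  num_points iota p = (affine_points p + 1)%N.
Proof.
move=> k0 d0 hp; have ik0 : iota k != 0 by rewrite fmorph_eq0.
have evt x y : ev iota x y (k *: crd1 ^+ d) = iota k * x ^+ d.
  by rewrite evZ rmorphXn ev_crd1.
rewrite (num_pointsE _ _ _ hp); last first.
  by apply: (@ev_neq0 1 0); rewrite evt expr1n mulr1.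
rewrite /infinity_points evt expr0n eqn0Ngt d0 mulr0 eqxx.
rewrite (_ : [set y | _] = set0) ?cards0 //.
by apply/setP => y; rewrite !inE evt expr1n mulr1 (negPf ik0).
Qed.

Lemma num_points_line p k : leading_form 1 p (crd2 - k *: crd1) ->
  num_points iota p = (affine_points p + 1)%N.
Proof.
move=> hp.
have evt x y : ev iota x y (crd2 - k *: crd1) = y - iota k * x.
  by rewrite rmorphB evZ ev_crd1 ev_crd2.
have ev01 : ev iota 0 1 (crd2 - k *: crd1) != 0.
  by rewrite evt mulr0 subr0 oner_neq0.
rewrite (num_pointsE _ _ _ hp) ?(ev_neq0 _ _ _ ev01) // /infinity_points.
rewrite (negPf ev01) addn0 (_ : [set y | _] = [set iota k]) ?cards1 //.
by apply/setP => y; rewrite !inE evt mulr1 subr_eq0.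
Qed.

Lemma num_points_conic p k : leading_form 2 p (crd2 ^+ 2 - k *: crd1 ^+ 2) ->
  num_points iota p =
  (affine_points p + #|[set z : L | (z ^+ 2 == iota k)%R]|)%N.
Proof.
move=> hp.
have evt x y : ev iota x y (crd2 ^+ 2 - k *: crd1 ^+ 2)
    = y ^+ 2 - iota k * x ^+ 2.
  by rewrite rmorphB evZ !rmorphXn ev_crd1 ev_crd2.
have ev01 : ev iota 0 1 (crd2 ^+ 2 - k *: crd1 ^+ 2) != 0.
  by rewrite evt expr0n mulr0 subr0 expr1n oner_neq0.
rewrite (num_pointsE _ _ _ hp) ?(ev_neq0 _ _ _ ev01) // /infinity_points.
rewrite (negPf ev01) addn0; congr (_ + _)%N; apply: eq_card => y.
by rewrite !inE evt expr1n mulr1 subr_eq0.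
Qed.

Lemma crd1_homog : (crd1 : {mpoly K[2]}) \is 1.-homog.
Proof. by rewrite /crd1 dhomogX /= mdeg1. Qed.

Lemma crd2_homog : (crd2 : {mpoly K[2]}) \is 1.-homog.
Proof. by rewrite /crd2 dhomogX /= mdeg1. Qed.

Lemma leading_crd1X d : leading_form d (crd1 ^+ d : {mpoly K[2]}) (crd1 ^+ d).
Proof.
by apply: leading_form_homog; have := dhomogMn d crd1_homog; rewrite mul1n.
Qed.

Lemma leading_crd2X d : leading_form d (crd2 ^+ d : {mpoly K[2]}) (crd2 ^+ d).
Proof.
by apply: leading_form_homog; have := dhomogMn d crd2_homog; rewrite mul1n.
Qed.

Lemma leading_quadratic (a b c : K) :
  leading_form 2 (quadratic a b c crd1 : {mpoly K[2]}) (a *: crd1 ^+ 2).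
Proof.
have lead1 := leading_form_lower (ltnSn 1) (leading_formZ b (leading_crd1X 1)).
have lead0 := leading_form_lower (ltn0Sn 1) (leading_formZ c (leading_crd1X 0)).
have lead2 := leading_formZ a (leading_crd1X 2).
have := leading_formD (leading_formD lead2 lead1) lead0.
by rewrite !addr0.
Qed.

Lemma leading_linear (B C : K) :
  leading_form 1 (quadratic 0 B C crd1 : {mpoly K[2]}) (B *: crd1).
Proof.
have lead0 := leading_form_lower (ltn0Sn 0) (leading_formZ C (leading_crd1X 0)).
have := leading_formD (leading_formZ B (leading_crd1X 1)) lead0.
by rewrite addr0 /quadratic scale0r add0r.
Qed.

(** Stated for a common shape k x^e whatever the degree e of the polynomial is,
    so that the degrees can be compared uniformly for the curve C_1. *)
Lemma leading_quadratic_exists (A B C : K) : ~ [/\ A = 0, B = 0 & C = 0] ->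
  exists e k, [/\ k != 0,
    leading_form e (quadratic A B C crd1 : {mpoly K[2]}) (k *: crd1 ^+ e),
    (e < 2)%N -> A = 0 & (e < 1)%N -> B = 0].
Proof.
move=> ABC; have [A0|A0] := eqVneq A 0; last first.
  by exists 2%N, A; split=> //; apply: leading_quadratic.
rewrite A0 in ABC *; have [B0|B0] := eqVneq B 0; last first.
  by exists 1%N, B; split=> //; apply: leading_linear.
exists 0%N, C; split=> //; first by apply/eqP => C0; apply: ABC.
rewrite /quadratic B0 !scale0r !add0r.
exact: (leading_formZ C (leading_crd1X 0)).
Qed.

Lemma num_points_curve2 i (A B C a b c : K) : a != 0 -> (0 < i)%N ->
  num_points iota (curve2 i A B C a b c) =
  (affine_points (curve2 i A B C a b c) + 2)%N.
Proof.
move=> a0 i0.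
have hp : leading_form (i + 2) (curve2 i A B C a b c)
    (crd2 ^+ i * (a *: crd1 ^+ 2)).
  have low : (2 < i + 2)%N by rewrite -[X in (X < _)%N]add0n ltn_add2r.
  have high := leading_formM (leading_crd2X i) (leading_quadratic a b c).
  have lower := leading_form_lower low (leading_quadratic A B C).
  have := leading_formD high (leading_formN lower).
  by rewrite oppr0 addr0.
have evt x y : ev iota x y (crd2 ^+ i * (a *: crd1 ^+ 2))
    = y ^+ i * (iota a * x ^+ 2).
  by rewrite rmorphM evZ !rmorphXn ev_crd1 ev_crd2.
have ia0 : iota a != 0 by rewrite fmorph_eq0.
rewrite (num_pointsE _ _ _ hp); last first.
  by apply: (@ev_neq0 1 1); rewrite evt !expr1n mul1r mulr1.
rewrite /infinity_points evt expr0n !mulr0 eqxx.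
rewrite (_ : [set y | _] = [set 0]) ?cards1 //.
apply/setP => y; rewrite !inE evt expr1n mulr1 mulf_eq0 (negPf ia0) orbF.
by rewrite expf_eq0 i0.
Qed.

(** With e the degree of A x^2 + B x + C, the product on the right of the
    equation has degree e + 2 (i - 1), and its leading term dominates y^i unless
    the curve is a line (i = 1, e <= 1) or in the excluded case
    (i = 2, e = 0), where y^2 would contribute at infinity. *)
Lemma num_points_curve1 i (A B C a b c : K) : a != 0 -> (0 < i)%N ->
  ~ [/\ A = 0, B = 0 & C = 0] -> ~ [/\ i = 2%N, A = 0 & B = 0] ->
  num_points iota (curve1 i A B C a b c) =
  (affine_points (curve1 i A B C a b c) + 1)%N.
Proof.
move=> a0 i0 ABC excl.
have [e [k [k0 hg eA eB]]] := leading_quadratic_exists _ _ _ ABC.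
have hgf := leading_formM hg (leading_formX i.-1 (leading_quadratic a b c)).
rewrite exprZn -exprM -scalerAr -scalerAl scalerA -exprD in hgf.
have [lt_id|le_di] := ltnP i (e + 2 * i.-1).
  apply: (@num_points_pure (e + 2 * i.-1) _ (- (k * a ^+ i.-1))).
  - by rewrite oppr_eq0 mulf_neq0 ?expf_neq0.
  - exact: leq_ltn_trans (leq0n i) lt_id.
  have := leading_formD (leading_form_lower lt_id (leading_crd2X i))
                        (leading_formN hgf).
  by rewrite add0r scaleNr [k * _]mulrC.
case: i i0 excl le_di {hgf} => [//|[|[|i]]] _ excl le_di.
- rewrite addn0 in le_di; rewrite /curve1 (eA le_di) expr0 mulr1.
  apply: (@num_points_line _ B).
  exact: leading_formD (leading_crd2X 1) (leading_formN (leading_linear B C)).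
- have e_lt1 : (e < 1)%N by rewrite -(ltn_add2r 2).
  by case: excl; split=> //; [apply: eA; apply: ltnW | apply: eB].
by move: le_di => /=; clear; lia.
Qed.

(** The right-hand side of the equation is a trinomial
    D2 y^(2 i) + D1 y^i + D0, with D2 = b^2 - 4 a c and
    D1 = 4 A c + 4 C a - 2 B b. Either its degree is greater than 2, and
    (0 : 1 : 0) is the only point at infinity, or the leading form is
    z^2 - k y^2, where k is the coefficient of y^2 in the trinomial. *)
Lemma num_points_curve0 i (A B C a b c : K) (chi2 : 'CF([set: {unit L}])) :
  (0 < i)%N -> chi2 \is a linear_char -> #[chi2]%CF = 2%N ->
  (num_points iota (curve0 i A B C a b c))%:R =
  (affine_points (curve0 i A B C a b c))%:R + delta iota chi2 i A B C a b c.
Proof.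
move=> i0 chi2_lin chi2_2.
have card_sqrt (d : L) :
    #|[set z : L | (z ^+ 2 == d)%R]|%:R = 1 + mchar chi2 d :> algC.
  by have := card_power_fibre chi2_lin d; rewrite chi2_2 big_nat1.
set D2 := b ^+ 2 - 4 * a * c; set D1 := 4 * A * c + 4 * C * a - 2 * B * b.
pose D0 := B ^+ 2 - 4 * A * C.
have curveE : curve0 i A B C a b c =
    crd2 ^+ 2 - (D2 *: crd1 ^+ (i * 2) + D1 *: crd1 ^+ i + D0 *: crd1 ^+ 0).
  rewrite /curve0 /D2 /D1 /D0 exprM -!mul_mpolyC expr0.
  rewrite !(rmorphB, rmorphD, rmorphM, rmorphXn, rmorph_nat) /=.
  move: (crd1 ^+ i) crd2 (A%:MP_[2]) (B%:MP_[2]) (C%:MP_[2]).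
  move: (a%:MP_[2]) (b%:MP_[2]) (c%:MP_[2]).
  by move=> a' b' c' y z A' B' C'; ring.
set p := curve0 _ _ _ _ _ _ _ in curveE *.
have lead k j := leading_formZ k (leading_crd1X j).
pose q : {mpoly K[2]} := D2 *: crd1 ^+ (i * 2) + D1 *: crd1 ^+ i.
have top d t1 t2 : leading_form d (crd2 ^+ 2 : {mpoly K[2]}) t1 ->
    leading_form d q t2 -> (0 < d)%N -> leading_form d p (t1 - t2).
  move=> h1 h2 d0; rewrite curveE.
  have := leading_formD h2 (leading_form_lower d0 (lead D0 0%N)).
  by rewrite addr0 => /leading_formN/(leading_formD h1).
have pure d k : k != 0 -> (2 < d)%N ->
    leading_form d q (k *: crd1 ^+ d) ->
    (num_points iota p)%:R = (affine_points p)%:R + 1 :> algC.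
  move=> k0 d2 hk; have d0 : (0 < d)%N by apply: leq_ltn_trans d2.
  rewrite (@num_points_pure d _ (- k)) ?natrD ?oppr_eq0 //.
  have := top _ _ _ (leading_form_lower d2 (leading_crd2X 2)) hk d0.
  by rewrite sub0r scaleNr.
have conic k :
    leading_form 2 q (k *: crd1 ^+ 2) ->
    (num_points iota p)%:R =
    (affine_points p)%:R + (1 + mchar chi2 (iota k)) :> algC.
  move=> hk; rewrite (@num_points_conic _ k) ?natrD ?card_sqrt //.
  by apply: top hk _ => //; apply: leading_crd2X.
rewrite {}/q in top pure conic.
rewrite /delta -/D1 -/D2; case: eqP => [i1|/eqP i1] /=.
  apply: conic; rewrite i1 -[X in leading_form _ _ X]addr0.
  apply: leading_formD (lead D2 2%N) _.
  exact: leading_form_lower (ltnSn 1) (lead D1 1%N).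
have i2 : (1 < i)%N by rewrite ltn_neqAle eq_sym i1.
have [D20|D20] := eqVneq D2 0; last first.
  rewrite andbF; apply: (pure (i * 2)%N D2) => //.
    by move: i2; clear; lia.
  rewrite -[X in leading_form _ _ X]addr0.
  apply: leading_formD (lead D2 _) (leading_form_lower _ (lead D1 i)).
  by move: i0; clear; lia.
rewrite D20 scale0r add0r in conic pure; rewrite andbT.
case: eqP => [ei2|/eqP i_neq2].
  by apply: conic; rewrite ei2; apply: lead.
have i3 : (2 < i)%N by rewrite ltn_neqAle eq_sym i_neq2.
have [D10|D10] := eqVneq D1 0; last by apply: (pure i D1).
rewrite D10 scale0r in conic.
(* Here the trinomial is constant and z^2 = 0 has a single zero at infinity. *)
rewrite (conic 0) -?card_sqrt; last first.
  by rewrite scale0r; apply: leading_form_homog; apply: dhomog0.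
rewrite rmorph0 (_ : [set z | _] = [set 0]) ?cards1 //.
by apply/setP => z; rewrite !inE sqrf_eq0.
Qed.
End Infinity.

(** * Roots of the denominator and the point counts *)

Lemma horner_map_quadratic (K L : fieldType) (iota : {rmorphism K -> L})
    (a b c : K) (x : L) :
  (map_poly iota (quadratic a b c 'X)).[x] =
  iota a * x ^+ 2 + iota b * x + iota c.
Proof.
rewrite /quadratic !rmorphD /= !map_polyZ /= rmorphXn /= rmorph1 map_polyX.
by rewrite !hornerE.
Qed.

(** Inside the overfield the roots of f are alpha1 and alpha2. Their sum -b/a
    lies in the base field, so one of them comes from L if and only if the other
    does, and gamma may test alpha1 only. *)
Lemma card_roots_gamma (K L E : finFieldType) (M : fieldType)
    (iL : {rmorphism K -> L}) (iE : {rmorphism K -> E})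
    (jL : {rmorphism L -> M}) (jE : {rmorphism E -> M})
    (a b c : K) (alpha1 alpha2 : E) :
  (forall x : K, jL (iL x) = jE (iE x)) -> a != 0 ->
  map_poly iE (quadratic a b c 'X)
    = iE a *: (('X - alpha1%:P) * ('X - alpha2%:P)) ->
  #|[set x : L | iL a * x ^+ 2 + iL b * x + iL c == 0]|
  = gamma jL jE alpha1 alpha2.
Proof.
move=> agree a0 roots_f.
have ea0 : iE a != 0 by rewrite fmorph_eq0.
have fE x : iE a * x ^+ 2 + iE b * x + iE c
    = iE a * ((x - alpha1) * (x - alpha2)).
  by rewrite -horner_map_quadratic roots_f !hornerE.
have c_prod : iE c = iE a * (alpha1 * alpha2).
  by have := fE 0; rewrite expr0n !mulr0 !add0r mulrNN.
have b_sum : iE b = - iE a * (alpha1 + alpha2).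
  have := fE 1; rewrite c_prod expr1n !mulr1 => e.
  have -> : iE b = (iE a + iE b + iE a * (alpha1 * alpha2))
                   - iE a - iE a * (alpha1 * alpha2) by ring.
  by rewrite e; ring.
have fL x : (iL a * x ^+ 2 + iL b * x + iL c == 0)
    = (jL x == jE alpha1) || (jL x == jE alpha2).
  rewrite -(fmorph_eq0 jL) !(rmorphD, rmorphM, rmorphXn) /= !agree b_sum c_prod.
  rewrite !(rmorphD, rmorphN, rmorphM) /= -[_ == jE alpha1]subr_eq0.
  rewrite -[_ == jE alpha2]subr_eq0 -mulf_eq0.
  have ja0 : jE (iE a) != 0 by rewrite fmorph_eq0.
  rewrite -[RHS](inj_eq (mulfI ja0)) mulr0; congr (_ == 0).
  move: (jL x) (jE (iE a)) (jE alpha1) (jE alpha2) => X T U V; ring.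
(* The two roots are exchanged by x |-> - b / a - x. *)
have conj x al al' : alpha1 + alpha2 = al + al' -> jL x = jE al ->
    jL (- iL b / iL a - x) = jE al'.
  move=> al_sum xal; rewrite rmorphB fmorph_div rmorphN /= !agree xal -rmorphN.
  rewrite -fmorph_div -rmorphB b_sum !mulNr opprK [iE a * _]mulrC mulfK //.
  by rewrite al_sum addrC addKr.
rewrite /gamma; case: existsP => [[x /eqP x1]|none] /=; last first.
  rewrite addn0; apply/eqP; rewrite cards_eq0; apply/eqP/setP => x.
  rewrite !inE fL; apply/negP => /orP[/eqP x1|/eqP x2]; apply: none.
    by exists x; apply/eqP.
  by eexists; apply/eqP; apply: conj x2; rewrite addrC.
have x2 := conj _ _ _ (erefl _) x1; set y := _ - x in x2.
rewrite (_ : [set _ | _] = [set x; y]); last first.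
  by apply/setP => z; rewrite !inE fL -x1 -x2 !(inj_eq (fmorph_inj jL)).
rewrite cards2 -(inj_eq (fmorph_inj jE)) -x1 -x2 (inj_eq (fmorph_inj jL)).
by rewrite add1n.
Qed.

Theorem theorem1p3
  (K L E : finFieldType) (M : closedFieldType)
  (iL : {rmorphism K -> L}) (iE : {rmorphism K -> E})
  (jL : {rmorphism L -> M}) (jE : {rmorphism E -> M})
  (embeddings_agree : forall x : K, jL (iL x) = jE (iE x))
  (n i : nat)
  (q_odd : odd #|K|)
  (n_ge1 : (1 <= n)%N)
  (card_L : #|L| = (#|K| ^ n)%N)
  (card_E : #|E| = (#|K| ^ 2)%N)
  (i_ge1 : (1 <= i)%N)
  (i_dvd : (i %| #|K| ^ n - 1)%N)
  (A B C a b c : K)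
  (a_neq0 : a != 0)
  (alpha1 alpha2 : E)
  (roots_f : map_poly iE (quadratic a b c 'X)
             = (iE a) *: (('X - alpha1%:P) * ('X - alpha2%:P)))
  (chi chi2 : 'CF([set: {unit L}]))
  (chi_lin : chi \is a linear_char) (chi_order : #[chi]%CF = i)
  (chi2_lin : chi2 \is a linear_char) (chi2_order : #[chi2]%CF = 2%N)
  (not_proportional :
     ~ exists t : L, [/\ iL A = t ^+ i * iL a, iL B = t ^+ i * iL b
                       & iL C = t ^+ i * iL c]) :
  ((~ exists x : L, root (map_poly iL (quadratic A B C 'X)) x
                    /\ root (map_poly iL (quadratic a b c 'X)) x) ->
   ~ [/\ i = 2%N, A = 0 & B = 0] ->
   (num_points iL (curve1 i A B C a b c))%:R
   = (num_points iL (curve0 i A B C a b c))%:R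
     - \sum_(1 <= j < i) mchar chi (iL (A / a)) ^+ j
     - delta iL chi2 i A B C a b c
     + (gamma jL jE alpha1 alpha2)%:R)
  /\
  (num_points iL (curve2 i A B C a b c))%:R
  = (num_points iL (curve0 i A B C a b c))%:R + 1
    - \sum_(1 <= j < i) mchar chi (iL (A / a)) ^+ j
    - delta iL chi2 i A B C a b c.
Proof.
have two_neq0 : (2 : L) != 0.
  by rewrite -(rmorph_nat iL) fmorph_eq0 odd_card_2_neq0.
have la0 : iL a != 0 by rewrite fmorph_eq0.
have count2 := @affine_count2 L two_neq0 i _ (iL B) (iL C) _ (iL b) (iL c)
  la0 not_proportional.
have count_powers := card_power_fibre chi_lin (iL A / iL a).
rewrite chi_order in count_powers.
have affine2 : affine_points iL (curve2 i A B C a b c)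
  = #|[set xy : L * L | xy.2 ^+ i * (iL a * xy.1 ^+ 2 + iL b * xy.1 + iL c)
                        == iL A * xy.1 ^+ 2 + iL B * xy.1 + iL C]|.
  by apply: eq_card => xy; rewrite !inE ev_curve2 subr_eq0.
have affine0 : affine_points iL (curve0 i A B C a b c)
  = #|[set yz : L * L | yz.2 ^+ 2 ==
       (iL B - iL b * yz.1 ^+ i) ^+ 2
       - 4 * (iL A - iL a * yz.1 ^+ i) * (iL C - iL c * yz.1 ^+ i)]|.
  by apply: eq_card => yz; rewrite !inE ev_curve0 subr_eq0.
rewrite -affine2 -affine0 in count2.
have {count_powers}affine20 : (affine_points iL (curve2 i A B C a b c))%:R
    + (1 + \sum_(1 <= j < i) mchar chi (iL (A / a)) ^+ j)
    = (affine_points iL (curve0 i A B C a b c))%:R :> algC.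
  by rewrite fmorph_div -count_powers -natrD count2.
rewrite (num_points_curve0 iL i A B C a b c chi2) // -affine20.
split=> [no_common excl|]; last by rewrite num_points_curve2 // natrD; ring.
have ABC : ~ [/\ A = 0, B = 0 & C = 0].
  case=> A0 B0 C0; apply: not_proportional; exists 0.
  by rewrite A0 B0 C0 !rmorph0 expr0n eqn0Ngt i_ge1 !mul0r.
rewrite num_points_curve1 // -(card_roots_gamma _ _ _ _ iL iE jL jE a b c) //.
have -> : affine_points iL (curve1 i A B C a b c)
  = #|[set xy : L * L | xy.2 ^+ i ==
        (iL A * xy.1 ^+ 2 + iL B * xy.1 + iL C)
        * (iL a * xy.1 ^+ 2 + iL b * xy.1 + iL c) ^+ i.-1]|.
  by apply: eq_card => xy; rewrite !inE ev_curve1 subr_eq0.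
rewrite affine_count1 // -?affine2; last first.
  case=> x [gx fx]; apply: no_common; exists x.
  by rewrite /root !horner_map_quadratic gx fx.
by rewrite !natrD; ring.
Qed.
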